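(* Let $n,p\ge 1$ be integers, let $q\in(0,\infty]$, and let $0\le \sigma\le B$. Then \[ \mathcal{E}_q^*(\sigma,B)\;\le\;\mathcal{E}_q(\sigma,B)\;\le\;16\,\mathcal{E}_q^*(\sigma,B). \]
   Context: For independent random vectors $\boldsymbol{X}_1,\dots,\boldsymbol{X}_n$ in $\mathbb{R}^p$ with joint law $P^n=\prod_{i=1}^n P_i$ and $\mathbb{E}[\boldsymbol{X}_i]=0$ for all $i$, write $X_i(j)$ for the $j$-th coordinate and set $\mathcal{V}(P^n)=\max_{1\le j\le p}\frac1n\sum_{i=1}^n\mathbb{E}[X_i(j)^2]$ and $\mathcal{D}_q(P^n)=\big(\frac1n\sum_{i=1}^n\mathbb{E}[\max_{1\le j\le p}|X_i(j)|^q]\big)^{1/q}$. For $q=\infty$, the constraint $\mathcal{D}_q(P^n)\le B$ means $\mathbb{P}(\max_{1\le i\le n}\|\boldsymbol{X}_i\|_\infty> B)=0$. Define \[ \mathcal{E}_q(\sigma,B)=\sup\Big\{\mathbb{E}_{P^n}\Big[\max_{1\le j\le p}\Big|\frac1n\sum_{i=1}^n X_i(j)\Big|\Big]:\ \mathcal{V}(P^n)\le\sigma^2,\ \mathcal{D}_q(P^n)\le B\Big\}, \] the supremum over all such laws of independent mean-zero random vectors. Let $\mathcal{P}_q(\sigma,B)$ be the set of probability distributions $P$ on $\mathbb{R}^p$ with $\mathbb{E}_P[\boldsymbol{X}]=0$, $\max_{1\le j\le p}\mathbb{E}_P[X(j)^2]\le\sigma^2$ and $(\mathbb{E}_P[\|\boldsymbol{X}\|_\infty^q])^{1/q}\le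 B$, and \[ \mathcal{E}_q^*(\sigma,B)=\sup\Big\{\mathbb{E}_P\Big[\Big\|\frac1n\sum_{i=1}^n\boldsymbol{X}_i\Big\|_\infty\Big]:\ \boldsymbol{X}_1,\dots,\boldsymbol{X}_n\overset{iid}{\sim}P,\ P\in\mathcal{P}_q(\sigma,B)\Big\}. \] *)

(* Defs.v *)
From HB Require Import structures.
From mathcomp Require Import all_boot all_order all_algebra.
From mathcomp Require Import all_classical all_reals all_analysis.
Set Implicit Arguments.
Unset Strict Implicit.
Unset Printing Implicit Defensive.
Import Order.TTheory GRing.Theory Num.Theory.
Import numFieldNormedType.Exports.
Local Open Scope classical_set_scope.
Local Open Scope ring_scope.

(* Vectors of R^p are p.-tuples of reals, with the product (= Borel)
   sigma-algebra provided by MathComp-Analysis on tuples. *)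
Notation vecR R p := (p.-tuple R).

Section Defs.
Variable R : realType.

Definition supnorm (p : nat) (x : vecR R p) : R :=
  \big[Order.max/0]_(j < p) `|tnth x j|.

(* Expectation of a (nonnegative) function of (X_1,...,X_n) when the X_i are
   independent with laws P_i, i.e. integral w.r.t. the product law
   prod_i P_i, written as an iterated integral (Tonelli). *)
Fixpoint iter_int (n p : nat) (P : 'I_n -> probability (vecR R p) R)
  (s : seq 'I_n) (f : ('I_n -> vecR R p) -> \bar R) (x : 'I_n -> vecR R p)
  : \bar R :=
  match s with
  | [::] => f x
  | i :: s' => (\int[P i]_y iter_int P s' f (fun j => if j == i then y else x j))%E
  end.

Definition prod_expect (n p : nat) (P : 'I_n -> probability (vecR R p) R)
  (f : ('I_n -> vecR R p) -> \bar R) : \bar R :=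
  iter_int P (enum 'I_n) f (fun _ => [tuple of nseq p 0]).

Definition max_avg (n p : nat) (x : 'I_n -> vecR R p) : R :=
  \big[Order.max/0]_(j < p) `| n%:R^-1 * \sum_(i < n) tnth (x i) j |.

Definition mean_zero (p : nat) (P : probability (vecR R p) R) : Prop :=
  forall j : 'I_p, P.-integrable setT (fun x => (tnth x j)%:E) /\
    (\int[P]_x (tnth x j)%:E = 0)%E.

Definition second_moment (p : nat) (P : probability (vecR R p) R) (j : 'I_p)
  : \bar R := (\int[P]_x ((tnth x j) ^+ 2)%:E)%E.

Definition sup_moment (p : nat) (P : probability (vecR R p) R) (r : R)
  : \bar R := (\int[P]_x ((supnorm x) `^ r)%:E)%E.

Definition V_le (n p : nat) (P : 'I_n -> probability (vecR R p) R) (sigma : R)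
  : Prop :=
  forall j : 'I_p,
    (n%:R^-1%:E * \sum_(i < n) second_moment (P i) j <= (sigma ^+ 2)%:E)%E.

Definition D_le (n p : nat) (P : 'I_n -> probability (vecR R p) R)
  (q : \bar R) (B : R) : Prop :=
  match q with
  | r%:E => ((n%:R^-1%:E * \sum_(i < n) sup_moment (P i) r) `^ r^-1 <= B%:E)%E
  | _ => prod_expect P (fun x =>
           (\1_[set y : 'I_n -> vecR R p |
                 B < \big[Order.max/0]_(i < n) supnorm (y i)] x)%:E) = 0%E
  end.

Definition Eq (n p : nat) (q : \bar R) (sigma B : R) : \bar R :=
  ereal_sup [set v | exists P : 'I_n -> probability (vecR R p) R,
    [/\ forall i, mean_zero (P i), V_le P sigma, D_le P q B &
        v = prod_expect P (fun x => (max_avg x)%:E)]].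

Definition Pq (p : nat) (q : \bar R) (sigma B : R)
  (P : probability (vecR R p) R) : Prop :=
  [/\ mean_zero P,
      forall j : 'I_p, (second_moment P j <= (sigma ^+ 2)%:E)%E &
      match q with
      | r%:E => ((sup_moment P r) `^ r^-1 <= B%:E)%E
      | _ => P [set x | B < supnorm x] = 0%E
      end].

Definition Eq_star (n p : nat) (q : \bar R) (sigma B : R) : \bar R :=
  ereal_sup [set v | exists P : probability (vecR R p) R,
    Pq q sigma B P /\ v = prod_expect (fun _ : 'I_n => P) (fun x => (max_avg x)%:E)].

End Defs.

(* Main.v *)
(* The mixture Q = (P_1 + ... + P_n) / n satisfies the same moment constraints
   as (P_1, ..., P_n), so it suffices to compare E || sum_i X_i || with
   E || sum_k Y_k || for Y_1, ..., Y_n iid from Q.  Drawing Y_k amounts to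
   choosing a uniform index i and drawing a fresh copy of X_i; repeated copies
   of the same X_i can be averaged out by Jensen's inequality, and averaging
   over the random indices (Jensen once more) leaves E || sum_i t X_i || as a
   lower bound, where t = 1 - (1 - 1/n)^n >= 1/2 is the probability that index
   i is chosen.  This gives the upper bound with the constant 2. *)
Require Import Defs.
From HB Require Import structures.
From mathcomp Require Import all_boot all_order all_algebra.
From mathcomp Require Import all_classical all_reals all_analysis.
From mathcomp Require Import measurable_realfun ring lra.
Import Order.TTheory GRing.Theory Num.Theory.
Local Open Scope ring_scope.

(** * Integrals of nonnegative functions *)

(** The integral of a nonnegative function is a supremum over the simple functions below it, hence
    monotone even for the possibly non-measurable integrands of iterated integrals. *)
Lemma ge0_le_integralT d (T : measurableType d) (R : realType)
    (mu : {measure set T -> \bar R}) (f g : T -> \bar R) :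
  (forall x, 0 <= f x)%E -> (forall x, f x <= g x)%E ->
  (\int[mu]_x f x <= \int[mu]_x g x)%E.
Proof.
move=> f0 fg; rewrite !ge0_integralTE//; last first.
  by move=> x; exact: le_trans (fg x).
apply: le_ereal_sup => _ /= [h hf <-]; exists h => // x.
exact: le_trans (fg x).
Qed.

Lemma integral_cst_probability d (T : measurableType d) (R : realType)
    (P : probability T R) (c : \bar R) : (\int[P]_x c = c)%E.
Proof. by rewrite integral_cst// [X in (_ * X)%E]probability_setT mule1. Qed.

(** * The sup norm and affine shifts *)

Section supnorm.
Context {R : realType} {p : nat}.
Implicit Types (x y u v : p.-tuple R) (c a b : R).

Definition axpy c y v : p.-tuple R := [tuple tnth v j + c * tnth y j | j < p].

Lemma tnth_axpy c y v j : tnth (axpy c y v) j = tnth v j + c * tnth y j.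
Proof. by rewrite tnth_mktuple. Qed.

Lemma axpyAC a b x y v : axpy a x (axpy b y v) = axpy b y (axpy a x v).
Proof. by apply: eq_from_tnth => j; rewrite !tnth_axpy addrAC. Qed.

Lemma axpy0 y v : axpy 0 y v = v.
Proof. by apply: eq_from_tnth => j; rewrite tnth_axpy mul0r addr0. Qed.

Lemma supnorm_ge0 v : 0 <= supnorm v.
Proof. exact: bigmax_ge_id. Qed.

Lemma supnorm_ge v j : `|tnth v j| <= supnorm v.
Proof. exact: (le_bigmax_cond _ (fun j => `|tnth v j|)). Qed.

Lemma supnorm_le v c : 0 <= c -> (forall j, `|tnth v j| <= c) -> supnorm v <= c.
Proof. by move=> c0 vc; apply: bigmax_le. Qed.

Lemma measurable_axpy d (T : measurableType d) c (f g : T -> p.-tuple R) :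
  measurable_fun setT f -> measurable_fun setT g ->
  measurable_fun setT (fun t => axpy c (f t) (g t)).
Proof.
move=> mf mg; apply/measurable_fun_tnthP => j.
rewrite (_ : _ \o _ = (fun t => tnth (g t) j + c * tnth (f t) j)); last first.
  by apply/funext => t /=; rewrite tnth_axpy.
apply: measurable_funD; first by move/measurable_fun_tnthP : mg; exact.
by apply: measurable_funM => //; move/measurable_fun_tnthP : mf; exact.
Qed.

Lemma measurable_supnorm : measurable_fun setT (@supnorm R p).
Proof.
rewrite (_ : @supnorm R p =
    fun v => \big[Order.max/0]_(j <- enum 'I_p) `|tnth v j|); last first.
  by apply/funext => v; rewrite /supnorm big_enum.
elim: (enum 'I_p) => [|j s ih].
  by under eq_fun do rewrite big_nil; exact: measurable_cst.
under eq_fun do rewrite big_cons.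
apply: measurable_maxr => //.
by apply: measurableT_comp => //; exact: measurable_tnth.
Qed.

End supnorm.

(** * Averaging over one random shift *)

Section shift_operator.
Context {R : realType} {p : nat}.
Local Notation vec := (p.-tuple R).
Implicit Types (P Q : probability vec R) (h g : vec -> \bar R).

Definition nnmeas h := measurable_fun setT h /\ forall v, (0 <= h v)%E.

(** Treating one draw as an operator on functions of the running sum turns reordering of draws into
    commutation of operators. *)
Definition Eshift P c h v : \bar R := (\int[P]_y h (axpy c y v))%E.

Lemma measurable_shift c h v : measurable_fun setT h ->
  measurable_fun setT (fun y => h (axpy c y v)).
Proof.
move=> mh; apply: (measurableT_comp mh).
by apply: measurable_axpy => //; exact: measurable_cst.
Qed.

Lemma Eshift_ge0 P c h v : (forall v, 0 <= h v)%E -> (0 <= Eshift P c h v)%E.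
Proof. by move=> h0; apply: integral_ge0. Qed.

Lemma nnmeas_Eshift P c h : nnmeas h -> nnmeas (Eshift P c h).
Proof.
move=> [mh h0]; split; last by move=> v; exact: Eshift_ge0.
apply: (measurable_fun_fubini_tonelli_F (m2 := P)
  (fun z : vec * vec => h (axpy c z.2 z.1))) => //.
by apply: (measurableT_comp mh); exact: measurable_axpy.
Qed.

Lemma Eshift_le P c h g v : (forall v, 0 <= h v)%E -> (forall v, h v <= g v)%E ->
  (Eshift P c h v <= Eshift P c g v)%E.
Proof. by move=> h0 hg; apply: ge0_le_integralT. Qed.

(** Tonelli's theorem, since the two shifts commute. *)
Lemma EshiftC P Q a b h v : nnmeas h ->
  Eshift P a (Eshift Q b h) v = Eshift Q b (Eshift P a h) v.
Proof.
move=> [mh h0]; pose F (z : vec * vec) := h (axpy b z.2 (axpy a z.1 v)).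
have mF : measurable_fun setT F.
  apply: (measurableT_comp mh); apply: measurable_axpy => //.
  by apply: measurable_axpy => //; exact: measurable_cst.
have /= FE := fubini_tonelli (m1 := P) (m2 := Q) F mF (fun z => h0 _).
apply: etrans FE _.
by apply: eq_integral => y _; apply: eq_integral => x _; rewrite /F axpyAC.
Qed.

Lemma Eshift0 P h v : Eshift P 0 h v = h v.
Proof.
rewrite /Eshift; under eq_integral do rewrite axpy0.
exact: integral_cst_probability.
Qed.

Definition supnormE (v : vec) : \bar R := (supnorm v)%:E.

Lemma nnmeas_supnormE : nnmeas supnormE.
Proof.
split; last by move=> v; rewrite lee_fin supnorm_ge0.
by apply/measurable_EFinP; exact: measurable_supnorm.
Qed.

(** Jensen's inequality, done by coordinates: the mean of [v_j + c Y_j] is [v_j], and its absolute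
    value is at most the mean of the norm. *)
Lemma Eshift_supnorm_ge P c v : mean_zero P ->
  (supnormE v <= Eshift P c supnormE v)%E.
Proof.
move=> P0.
have [ms s0] := nnmeas_supnormE.
have bnd j : (`|tnth v j|%:E <= Eshift P c supnormE v)%E.
  have [iP eP] := P0 j.
  have icP : P.-integrable setT (fun y => (c%:E * (tnth y j)%:E)%E).
    exact: integrableZl.
  have iv : P.-integrable setT (cst (tnth v j)%:E).
    exact: finite_measure_integrable_cst.
  have -> : `|tnth v j|%:E =
      (`| \int[P]_y ((tnth v j)%:E + c%:E * (tnth y j)%:E) |)%E.
    rewrite integralD//= integralZl//= eP mule0 adde0.
    apply: (congr1 abse (x := (tnth v j)%:E)).
    by apply/esym; exact: integral_cst_probability.
  apply: le_trans (le_abse_integral _ _ _) _ => //.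
    exact/measurable_int/(integrableD _ iv icP).
  apply: ge0_le_integralT => // y.
  by rewrite -EFinM -EFinD /= lee_fin -tnth_axpy supnorm_ge.
(* Once the expectation is finite, it is a real bound on every coordinate, hence on their
   maximum. *)
have [E|] := eqVneq (Eshift P c supnormE v) +oo%E; first by rewrite E leey.
have := Eshift_ge0 P c _ v s0.
case: (Eshift P c supnormE v) bnd => //= r bnd r0 _.
by rewrite lee_fin supnorm_le// => j; rewrite -lee_fin.
Qed.

End shift_operator.

(** * The uniform mixture of the laws *)

Section mixture.
Context {d} {T : measurableType d} {R : realType} {n : nat}.
Context (P : 'I_n.+1 -> probability T R).

(** [msum] sums a sequence of measures indexed by naturals, hence the reindexing by [inord]. *)
Definition mixture : set T -> \bar R :=
  mscale (n.+1%:R^-1)%:nng (msum (fun k => P (inord k)) n.+1).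

HB.instance Definition _ := Measure.on mixture.

Lemma mixture_setT : mixture setT = 1%E.
Proof.
rewrite /mixture /mscale /= /msum /=.
rewrite (eq_bigr (fun=> 1%E)); last by move=> i _; exact: probability_setT.
rewrite sumEFin -EFinM big_const_ord iter_addr addr0.
by rewrite -mulr_natr mul1r mulVf// pnatr_eq0.
Qed.

HB.instance Definition _ :=
  Measure_isProbability.Build d T R mixture mixture_setT.

Lemma mixtureE A : mixture A = (n.+1%:R^-1%:E * \sum_(i < n.+1) P i A)%E.
Proof.
rewrite /mixture /mscale /= /msum /=; congr (_ * _)%E.
by apply: eq_bigr => i _; rewrite inord_val.
Qed.

Lemma ge0_integral_mixture (f : T -> \bar R) :
  (forall x, 0 <= f x)%E -> measurable_fun setT f ->
  (\int[mixture]_x f x = n.+1%:R^-1%:E * \sum_(i < n.+1) \int[P i]_x f x)%E.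
Proof.
move=> f0 mf; rewrite ge0_integral_mscale// ge0_integral_measure_sum//.
by congr (_ * _)%E; apply: eq_bigr => i _; rewrite inord_val.
Qed.

Lemma integrable_mixture (f : T -> \bar R) :
  (forall i, (P i).-integrable setT f) -> mixture.-integrable setT f.
Proof.
move=> fP; have mf := measurable_int _ (fP ord0).
apply/integrableP; split => //.
rewrite ge0_integral_mixture//; last exact: measurableT_comp.
rewrite lte_mul_pinfty//; apply/lte_sum_pinfty => i _.
by have /integrableP[] := fP i.
Qed.

(** Under each [P i] the positive and negative parts have equal finite integrals; averaging over [i]
    preserves this. *)
Lemma integral_mixture_eq0 (f : T -> \bar R) :
  (forall i, (P i).-integrable setT f /\ \int[P i]_x f x = 0)%E ->
  (\int[mixture]_x f x = 0)%E.
Proof.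
move=> fP; have mf := measurable_int _ (fP ord0).1.
rewrite integralE !ge0_integral_mixture//; last 2 first.
- exact: measurable_funeneg.
- exact: measurable_funepos.
have -> : (\sum_(i < n.+1) \int[P i]_x f^\+ x =
           \sum_(i < n.+1) \int[P i]_x f^\- x)%E.
  apply: eq_bigr => i _; have [fi fi0] := fP i.
  move: fi0; rewrite integralE => /eqP.
  rewrite sube_eq ?add0e; first by move=> /eqP.
    exact: integrable_pos_fin_num.
  exact/fin_num_adde_defl/integrable_neg_fin_num.
rewrite subee// fin_numM// sum_fin_num.
apply/allP => _ /mapP[i _ ->].
exact: (integrable_neg_fin_num measurableT (fP i).1).
Qed.

End mixture.

(** * Expected norms of weighted sums of independent draws *)

Section weighted_sums.
Context {R : realType} {n p : nat}.
Local Notation vec := (p.-tuple R).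
Implicit Types (P : 'I_n -> probability vec R) (s : seq 'I_n)
  (a b : 'I_n -> R) (v : vec).

(* [Enorm P s a v] is the expectation of [supnorm (v + \sum_(i <- s) a i X_i)]
   for independent draws [X_i] from [P i], one fresh draw per entry of [s]. *)
Fixpoint Enorm P s a : vec -> \bar R :=
  if s is i :: s' then Eshift (P i) (a i) (Enorm P s' a) else supnormE.

Lemma nnmeas_Enorm P s a : nnmeas (Enorm P s a).
Proof.
by elim: s => [|i s ih] /=; [exact: nnmeas_supnormE|exact: nnmeas_Eshift].
Qed.

Lemma Enorm_ge0 P s a v : (0 <= Enorm P s a v)%E.
Proof. by have [_] := nnmeas_Enorm P s a; exact. Qed.

Lemma eq_Enorm P s a b : {in s, a =1 b} -> Enorm P s a = Enorm P s b.
Proof.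
elim: s => //= i s ih ab; rewrite ab ?mem_head// ih// => j js.
by rewrite ab// inE js orbT.
Qed.

Lemma Enorm0 P s v : Enorm P s (fun=> 0) v = supnormE v.
Proof. by elim: s v => //= i s ih v; rewrite Eshift0. Qed.

(** Commutation moves the extra draw innermost, where it acts on the norm itself and Jensen
    applies. *)
Lemma Enorm_le_Eshift P (Q : probability vec R) s a c v : mean_zero Q ->
  (Enorm P s a v <= Eshift Q c (Enorm P s a) v)%E.
Proof.
move=> Q0; elim: s v => /= [|i s ih] v; first exact: Eshift_supnorm_ge.
rewrite EshiftC; last exact: nnmeas_Enorm.
by apply: Eshift_le => // w; exact: Enorm_ge0.
Qed.

(* A second, independent copy of [X_i] can be averaged out by Jensen's
   inequality, so only the fresh copy is kept. *)
Lemma Enorm_absorb P s a c i v : (forall j, mean_zero (P j)) ->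
  uniq s -> i \in s ->
  (Enorm P s (fun j => if j == i then c else a j) v <=
   Eshift (P i) c (Enorm P s a) v)%E.
Proof.
move=> P0; elim: s v => //= j s ih v /andP[js us].
rewrite inE EshiftC; last exact: nnmeas_Enorm.
have [ij _|_ /= si] := eqVneq i j; last first.
  by apply: Eshift_le => w; [exact: Enorm_ge0|exact: ih].
(* The index does not recur in the tail, so the modified weights agree with [a] there; the draw of
   weight [a i] is the one averaged out. *)
subst j; rewrite (eq_Enorm _ _ _ a); last first.
  by move=> k ks; case: eqVneq => // ki; rewrite -ki ks in js.
rewrite EshiftC; last exact: nnmeas_Enorm.
apply: Eshift_le => w; first exact: Enorm_ge0.
exact: Enorm_le_Eshift.
Qed.

(** The norm is sublinear and all terms share the same draws, so the inequality survives each
    integration. Arbitrary nonnegative [w] cover both averaging over indices and rescaling. *)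
Lemma Enorm_convex (I : finType) P s (w : I -> R) (a : I -> 'I_n -> R)
    (v : I -> vec) : (forall k, 0 <= w k) ->
  (Enorm P s (fun i => \sum_k w k * a k i)%R
     [tuple (\sum_k w k * tnth (v k) j)%R | j < p] <=
   \sum_k (w k)%:E * Enorm P s (a k) (v k))%E.
Proof.
move=> w0; elim: s v => /= [|i s ih] v.
  rewrite /supnormE; under eq_bigr do rewrite -EFinM.
  rewrite sumEFin lee_fin; apply: supnorm_le => [|j].
    by apply: sumr_ge0 => k _; rewrite mulr_ge0 ?supnorm_ge0.
  rewrite tnth_mktuple (le_trans (ler_norm_sum _ _ _))//.
  apply: ler_sum => k _; rewrite normrM ger0_norm//.
  by rewrite ler_wpM2l ?supnorm_ge.
rewrite /Eshift.
have [mE nE] : (forall k, measurable_fun setT (Enorm P s (a k))) /\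
               (forall k y, 0 <= Enorm P s (a k) y)%E.
  by split => k; have [] := nnmeas_Enorm P s (a k).
have mS k : measurable_fun setT (fun y => Enorm P s (a k) (axpy (a k i) y (v k))).
  exact: measurable_shift.
rewrite [leRHS](eq_bigr (fun k =>
    \int[P i]_y ((w k)%:E * Enorm P s (a k) (axpy (a k i) y (v k))))%E); last first.
  by move=> k _; rewrite ge0_integralZl// lee_fin.
rewrite -ge0_integral_sum//; last 2 first.
- by move=> k; exact: measurable_funeM.
- by move=> k y _; rewrite mule_ge0// lee_fin.
apply: ge0_le_integralT => [y|y]; first exact: Enorm_ge0.
apply: le_trans (ih (fun k => axpy (a k i) y (v k))).
rewrite le_eqVlt; apply/orP; left; apply/eqP; congr Enorm.
apply: eq_from_tnth => j; rewrite tnth_axpy !tnth_mktuple.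
rewrite mulr_suml -big_split/=; apply: eq_bigr => k _.
by rewrite tnth_axpy mulrDr mulrA.
Qed.

End weighted_sums.

(* Each draw from the mixture is, with probability [1/(n+1)], a fresh copy of
   [X_i]; absorbing it raises the average weight from [t c] to
   [(1 - (1 - t) n/(n+1)) c]. *)
Lemma Enorm_mixture (R : realType) (n p : nat)
    (P : 'I_n.+1 -> probability (p.-tuple R) R) (c : R) s v :
  (forall i, mean_zero (P i)) ->
  (Enorm P (enum 'I_n.+1)
     (fun=> (1 - (1 - n.+1%:R^-1) ^+ size s) * c)%R v <=
   Enorm (fun _ : 'I_n.+1 => mixture P : probability _ _) s (fun=> c) v)%E.
Proof.
move=> P0; elim: s v => /= [|_ s ih] v.
  by rewrite expr0 subrr mul0r Enorm0.
set t := 1 - (1 - n.+1%:R^-1) ^+ size s in ih.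
have := Eshift_le (mixture P) c _ _ v (Enorm_ge0 P _ _) ih.
apply: le_trans; rewrite /Eshift ge0_integral_mixture//; last 2 first.
- by move=> y; exact: Enorm_ge0.
- by apply: measurable_shift; have [] := nnmeas_Enorm P (enum 'I_n.+1) (fun=> t * c).
rewrite ge0_sume_distrr; last by move=> i _; apply: Eshift_ge0; exact: Enorm_ge0.
have ninv0 : 0 <= n.+1%:R^-1 :> R by rewrite invr_ge0.
have nn0 : n.+1%:R != 0 :> R by rewrite pnatr_eq0.
have sum1 : \sum_(k < n.+1) n.+1%:R^-1 = 1 :> R.
  by rewrite sumr_const card_ord -[LHS]mulr_natr mulVf.
(* Given the index [i] chosen by the mixture, the fresh copy of weight [c] replaces the one of
   weight [t * c]. *)
apply: (@le_trans _ _ (\sum_(i < n.+1) n.+1%:R^-1%:E *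
    Enorm P (enum 'I_n.+1) (fun j => if j == i then c else t * c)%R v)%E); last first.
  apply: lee_sum => i _; apply: lee_wpmul2l; first by rewrite lee_fin.
  by apply: Enorm_absorb; rewrite ?enum_uniq ?mem_enum.
(* Jensen over the uniform index: each weight becomes the average of one [c] and [n] copies of
   [t * c]. *)
apply: le_trans (Enorm_convex _ _ _ (fun=> n.+1%:R^-1)
  (fun i j => if j == i then c else t * c) (fun=> v) (fun=> ninv0)).
rewrite le_eqVlt; apply/orP; left; apply/eqP; congr Enorm; last first.
  apply: eq_from_tnth => j; rewrite tnth_mktuple -mulr_suml.
  by rewrite sum1 mul1r.
apply/funext => j; rewrite (bigD1 j)//= eqxx.
rewrite (eq_bigr (fun=> n.+1%:R^-1 * (t * c))); last first.
  by move=> k; rewrite eq_sym => /negPf ->.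
move: sum1; rewrite (bigD1 j)//= => /(canRL (addKr _)) E.
by rewrite -mulr_suml E /t exprS; ring.
Qed.

(** * Product expectations as iterated integrals *)

Section iterated_integral.
Context {R : realType} {n p : nat}.
Local Notation vec := (p.-tuple R).
Implicit Types (P : 'I_n -> probability vec R) (s : seq 'I_n)
  (f g : ('I_n -> vec) -> \bar R) (x : 'I_n -> vec).

Lemma iter_int_ge0 P s f x : (forall x, 0 <= f x)%E -> (0 <= iter_int P s f x)%E.
Proof. by move=> f0; elim: s x => //= i s ih x; apply: integral_ge0. Qed.

Lemma iter_int_le P s f g x : (forall x, 0 <= f x)%E ->
  (forall x, f x <= g x)%E -> (iter_int P s f x <= iter_int P s g x)%E.
Proof.
move=> f0 fg; elim: s x => //= i s ih x.
by apply: ge0_le_integralT => // y; exact: iter_int_ge0.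
Qed.

(** Marginalisation: integrating any other coordinate integrates a constant against a
    probability. *)
Lemma iter_int_coord P s (h : vec -> \bar R) i x : uniq s ->
  iter_int P s (fun y => h (y i)) x =
  if i \in s then (\int[P i]_y h y)%E else h (x i).
Proof.
elim: s x => //= k s ih x /andP[ks us].
under eq_integral do rewrite ih//.
rewrite inE; have [->|ki] := eqVneq i k.
  by rewrite (negPf ks).
by case: ifP => _; exact: integral_cst_probability.
Qed.

Lemma iter_int_eq0 P s f (A : set vec) x : measurable A ->
  (forall i, P i A = 0%E) -> (forall x, 0 <= f x)%E ->
  (forall x, (forall i, ~ A (x i)) -> f x = 0%E) ->
  (forall i, i \notin s -> ~ A (x i)) -> iter_int P s f x = 0%E.
Proof.
move=> mA PA0 f0 fA; elim: s x => /= [|i s ih] x xA.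
  by apply: fA => i; exact: xA.
apply/eqP; rewrite eq_le integral_ge0 ?andbT; last first.
  by move=> y _; exact: iter_int_ge0.
(* On the null set [A] the crude bound [+oo] suffices: its integral there is [+oo * 0 = 0]. *)
rewrite -[leRHS](mule0 +oo%E) -(PA0 i) -integral_cst// integral_mkcond.
apply: ge0_le_integralT => y; first exact: iter_int_ge0.
rewrite patchE; case: ifPn => [_|yA]; first exact: leey.
rewrite ih// => k ks; case: eqVneq => [_|ki].
  by move=> Ay; move: yA; rewrite mem_set.
by apply: xA; rewrite inE negb_or ki.
Qed.

(** Coordinates outside [s] stay frozen at [x] and form the starting vector; each integration moves
    one of them into the random sum. *)
Lemma iter_int_max_avg P s x : uniq s ->
  iter_int P s (fun x => (max_avg x)%:E) x =
  Enorm P s (fun=> n%:R^-1)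
    [tuple n%:R^-1 * \sum_(i | i \notin s) tnth (x i) j | j < p].
Proof.
elim: s x => /= [|i s ih] x.
  move=> _; rewrite /supnormE /max_avg /supnorm; congr EFin.
  by apply: eq_bigr => j _; rewrite tnth_mktuple.
move=> /andP[si us]; apply: eq_integral => y _; rewrite ih//; congr Enorm.
apply: eq_from_tnth => j; rewrite tnth_axpy !tnth_mktuple.
rewrite (bigD1 i)//= eqxx mulrDr addrC; congr (_ * _ + _).
rewrite (eq_bigl (fun k => k \notin i :: s)); last first.
  by move=> k /=; rewrite inE negb_or andbC.
by apply: eq_bigr => k; rewrite inE negb_or => /andP[/negPf ->].
Qed.

Lemma prod_expect_max_avg P : prod_expect P (fun x => (max_avg x)%:E) =
  Enorm P (enum 'I_n) (fun=> n%:R^-1) [tuple 0 | j < p].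
Proof.
rewrite /prod_expect iter_int_max_avg ?enum_uniq//; congr Enorm.
apply: eq_from_tnth => j; rewrite !tnth_mktuple big_pred0 ?mulr0// => i.
by rewrite mem_enum.
Qed.

(** Homogeneity of the norm, read off [Enorm_convex] with a single index of weight [t^-1]. *)
Lemma Enorm_le_scale P s a (t : R) : 0 < t ->
  (Enorm P s a [tuple 0%R | j < p] <=
   t^-1%:E * Enorm P s (fun i => t * a i)%R [tuple 0%R | j < p])%E.
Proof.
move=> t0; have tinv0 : 0 <= t^-1 by rewrite invr_ge0 ltW.
have := Enorm_convex _ P s (fun _ : 'I_1 => t^-1) (fun _ i => t * a i)
  (fun=> [tuple 0 | j < p]) (fun=> tinv0).
rewrite big_ord1; apply: le_trans.
rewrite le_eqVlt; apply/orP; left; apply/eqP; congr Enorm.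
  by apply/funext => i; rewrite big_ord1 mulKf// gt_eqF.
by apply: eq_from_tnth => j; rewrite !tnth_mktuple big_ord1 mulr0.
Qed.

Lemma measurable_supnorm_gt (B : R) : measurable [set v : vec | B < supnorm v]%classic.
Proof.
rewrite -[X in measurable X]setTI.
rewrite (_ : [set v | _]%classic = (@supnorm R p @^-1` `]B, +oo[)%classic); last first.
  by apply/seteqP; split => v /=; rewrite in_itv/= andbT.
by apply: measurable_supnorm => //; exact: measurable_itv.
Qed.

(** The sign of [B] matters because the maximum has default value [0]. *)
Lemma bigmax_supnorm_gtP (B : R) x : 0 <= B ->
  B < \big[Order.max/0]_(i < n) supnorm (x i) <-> exists i, B < supnorm (x i).
Proof.
move=> B0; split => [|[i Bi]]; last first.
  by apply: lt_le_trans Bi _; exact: (le_bigmax_cond _ (fun i => supnorm (x i))).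
apply: contraPP => /forallNP Bx; apply/negP; rewrite -leNgt.
by apply: bigmax_le => // i _; rewrite leNgt; apply/negP; exact: Bx.
Qed.

(** The event is the union over [i] of the events that coordinate [i] exceeds [B], so it is null
    exactly when each of them is. *)
Lemma prod_expect_gt_eq0 P (B : R) : 0 <= B ->
  prod_expect P (fun x => (\1_[set y : 'I_n -> vec |
    B < \big[Order.max/0]_(i < n) supnorm (y i)]%classic x)%:E) = 0%E <->
  forall i, P i [set v | B < supnorm v]%classic = 0%E.
Proof.
move=> B0; split => [E i|PB].
  apply/eqP; rewrite eq_le measure_ge0 andbT -E.
  rewrite (_ : P i _ =
      \int[P i]_v (\1_[set v | B < supnorm v]%classic v)%:E)%E; last first.
    by rewrite integral_indic// ?setIT//; exact: measurable_supnorm_gt.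
  have := iter_int_coord P (enum 'I_n)
    (fun v => (\1_[set v | B < supnorm v]%classic v)%:E) i
    (fun=> [tuple of nseq p 0]) (enum_uniq _).
  rewrite mem_enum => /esym/eqP; rewrite eq_le => /andP[leE _].
  apply: le_trans leE _.
  apply: iter_int_le => y; rewrite lee_fin !indicE//.
  rewrite ler_nat; case: (boolP (y i \in _)) => // /set_mem yi.
  by rewrite mem_set//; apply/bigmax_supnorm_gtP => //; exists i.
apply: (iter_int_eq0 _ _ _ [set v | B < supnorm v]%classic) => //.
- exact: measurable_supnorm_gt.
- move=> x xB; rewrite indicE memNset//= => /(bigmax_supnorm_gtP _ _ B0)[i].
  exact: xB.
- by move=> i; rewrite mem_enum.
Qed.

End iterated_integral.

(** * Numerical facts *)

Lemma mean_cste (R : realType) (n : nat) (x : \bar R) :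
  (n.+1%:R^-1%:E * \sum_(i < n.+1) x = x)%E.
Proof.
rewrite (eq_bigr (fun=> 1 * x)%E); last by move=> *; rewrite mul1e.
rewrite -ge0_sume_distrl// muleA sumEFin -EFinM sumr_const card_ord.
by rewrite mulVf ?mul1e// pnatr_eq0.
Qed.

(** With [x = 1/(n+1)], Bernoulli gives [(1 + x)^(n+1) >= 2], while [(1 - x^2)^(n+1) <= 1]. *)
Lemma expr_1subV_le (R : realType) (n : nat) :
  (1 - n.+1%:R^-1) ^+ n.+1 <= 2^-1 :> R.
Proof.
set x : R := n.+1%:R^-1.
have x0 : 0 <= x by rewrite invr_ge0.
have x1 : x <= 1 by rewrite invf_le1// ler1n.
have bern (m : nat) : 1 + m%:R * x <= (1 + x) ^+ m.
  elim: m => [|m ih]; first by rewrite mul0r addr0.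
  rewrite exprS; apply: (@le_trans _ _ ((1 + x) * (1 + m%:R * x))).
    have : 0 <= m%:R * x by rewrite mulr_ge0.
    rewrite -natr1; nra.
  by rewrite ler_wpM2l// addr_ge0.
have := bern n.+1; rewrite divff ?pnatr_eq0// => b.
have : ((1 - x) * (1 + x)) ^+ n.+1 <= 1 by rewrite exprn_ile1//; nra.
rewrite exprMn.
have : 0 <= (1 - x) ^+ n.+1 by rewrite exprn_ge0// subr_ge0.
move: b; set u := _ ^+ _; set w := _ ^+ _; nra.
Qed.

(** * Comparison of the two suprema *)

Section comparison.
Context {R : realType} {n p : nat}.
Local Notation vec := (p.-tuple R).
Context (q : \bar R) (sigma B : R) (q0 : (0 < q)%E) (B0 : 0 <= B).

Lemma V_D_le_cst (P : probability vec R) : Pq q sigma B P ->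
  V_le (fun _ : 'I_n.+1 => P) sigma /\ D_le (fun _ : 'I_n.+1 => P) q B.
Proof.
move=> [_ PV PD]; split; first by move=> j; rewrite mean_cste.
case: q q0 PD => [r| |] //= _; first by rewrite mean_cste.
by move=> PD; apply/prod_expect_gt_eq0.
Qed.

Lemma Pq_mixture (P : 'I_n.+1 -> probability vec R) :
  (forall i, mean_zero (P i)) -> V_le P sigma -> D_le P q B ->
  Pq q sigma B (mixture P : probability vec R).
Proof.
move=> P0 PV PD; split => [j|j|].
- by split; [apply: integrable_mixture|apply: integral_mixture_eq0] => i;
     have [] := P0 i j.
- rewrite /second_moment ge0_integral_mixture//; first exact: PV.
    by move=> v; rewrite lee_fin sqr_ge0.
  by apply/measurable_EFinP/measurable_funX; exact: measurable_tnth.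
(* Positivity of [q] rules out [-oo], leaving a finite exponent and the almost sure bound. *)
- case: q q0 PD => [r| |] //= _.
    rewrite /sup_moment ge0_integral_mixture//.
      by move=> v; rewrite lee_fin powR_ge0.
    apply/measurable_EFinP.
    exact: measurableT_comp (measurable_powR _) measurable_supnorm.
  move=> /prod_expect_gt_eq0 PB; rewrite mixtureE big1 ?mule0// => i _.
  exact: PB.
Qed.

Lemma prod_expect_mixture (P : 'I_n.+1 -> probability vec R) :
  (forall i, mean_zero (P i)) ->
  (prod_expect P (fun x => (max_avg x)%:E) <= 16%:E *
   prod_expect (fun _ : 'I_n.+1 => mixture P : probability vec R)
     (fun x => (max_avg x)%:E))%E.
Proof.
move=> P0; rewrite !prod_expect_max_avg.
have := Enorm_mixture _ _ _ P n.+1%:R^-1 (enum 'I_n.+1) [tuple 0 | j < p] P0.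
rewrite size_enum_ord; set t := 1 - _ => tle.
(* Rescaling by [t^-1] thus costs a factor of at most 2, within the required 16. *)
have t2 : 2^-1 <= t by have := expr_1subV_le R n; rewrite /t; lra.
have t0 : 0 < t by lra.
apply: le_trans (Enorm_le_scale _ _ _ t t0) _.
apply: lee_pmul => //.
- by rewrite lee_fin invr_ge0 ltW.
- exact: Enorm_ge0.
- by rewrite lee_fin invf_ple ?posrE//; lra.
Qed.

End comparison.

Theorem theorem2p1 (R : realType) (n p : nat) (q : \bar R) (sigma B : R) :
  (1 <= n)%N -> (1 <= p)%N -> (0 < q)%E -> 0 <= sigma -> sigma <= B ->
  (Eq_star n p q sigma B <= Eq n p q sigma B)%E /\
  (Eq n p q sigma B <= 16%:R%:E * Eq_star n p q sigma B)%E.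
Proof.
case: n => // n _ _ q0 sigma0 sigmaB.
have B0 : 0 <= B := le_trans sigma0 sigmaB.
split.
  apply: le_ereal_sup => _ [P [PP ->]]; exists (fun=> P).
  have [P0 _ _] := PP; have [PV PD] := V_D_le_cst (n := n) _ _ _ q0 B0 _ PP.
  by split.
apply: ub_ereal_sup => _ [P [P0 PV PD ->]].
apply: le_trans (prod_expect_mixture P P0) _.
apply: lee_wpmul2l => //; apply: ereal_sup_ubound.
by exists (mixture P); split => //; exact: Pq_mixture.
Qed.
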